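(* Let $m\ge 1$ and $n=2m+1$. Let $h\in\mathbb{R}[T]$ be a real polynomial and let $\mu_h=\varphi_h\circ\mu_0$. Then: (i) $\mu_h$ is a real circle form on $Y=W_2\times W_{2m+1}$; (ii) for $h,h'\in\mathbb{R}[T]$, the real circle forms $\mu_h$ and $\mu_{h'}$ are equivalent if and only if there exists $r\in\mathbb{R}^*$ such that $$h(T)\equiv r\,h'(r^2T) \pmod{T^m}.$$
   Context: For $k\ge1$, $W_k=\mathbb{C}^2$ is the $\mathbb{C}^*$-module with weights $(k,-k)$: $t\cdot(x,y)=(t^kx,t^{-k}y)$. Fix $m\ge1$, $n=2m+1$, and let $Y=W_2\times W_n\cong\mathbb{C}^4$ with coordinates $(a,b,x,y)$, so $t\cdot(a,b,x,y)=(t^2a,t^{-2}b,t^nx,t^{-n}y)$. Let $\sigma$ be the real form of $\mathbb{C}^*$ given by $\sigma(t)=\overline{t}^{-1}$. A real circle form on a $\mathbb{C}^*$-variety $Y$ is an antiholomorphic involution $\mu$ of $Y$ such that $\mu(t\cdot p)=\sigma(t)\cdot\mu(p)$ for all $t\in\mathbb{C}^*$, $p\in Y$. Two real circle forms $\mu_1,\mu_2$ are equivalent if there is a regular $\mathbb{C}^*$-equivariant automorphism $\psi$ of $Y$ with $\mu_2=\psi\circ\mu_1\circ\psi^{-1}$. Let $\mu_0(a,b,x,y)=(\overline{b},\overline{a},\overline{y},\overline{x})$. Set $T=ab$. For $h\in\mathbb{R}[T]$ let $$M_h=\begin{pmatrix}1-Th^2 & a^nh^n\\ -b^nh^n & \sum_{j=0}^{n-1}(Th^2)^j\end{pmatrix}\in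 GL_2(\mathbb{C}[a,b]),$$ where $h=h(T)=h(ab)$, and let $\varphi_h$ be the automorphism of $Y$ given by $\varphi_h(a,b,x,y)=\big(a,b,M_h\binom{x}{y}\big)$. *)

(* Defs.v *)
(* The complex field C is an arbitrary numClosedFieldType
   (algebraically closed field of char 0 with conjugation z^*, whose real
   elements Num.real form a real closed field), e.g. algC. *)
From HB Require Import structures.
From mathcomp Require Import all_boot all_order all_algebra.
Set Implicit Arguments. Unset Strict Implicit. Unset Printing Implicit Defensive.
Import Order.TTheory GRing.Theory Num.Theory.
Local Open Scope ring_scope.

Section Defs.
Variable C : numClosedFieldType.

(* Points of Y = W_2 x W_n = C^4 with coordinates (a,b,x,y). *)
Record pt := Pt { pa : C; pb : C; px : C; py : C }.

(* C^*-action: t.(a,b,x,y) = (t^2 a, t^-2 b, t^n x, t^-n y). *)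
Definition act (n : nat) (t : C) (p : pt) : pt :=
  Pt (t ^+ 2 * pa p) (t ^- 2 * pb p) (t ^+ n * px p) (t ^- n * py p).

(* The real form sigma(t) = conj(t)^-1 of C^*. *)
Definition sigma (t : C) : C := (t^*)^-1.

(* Regular (polynomial) functions Y -> C. *)
Inductive regfun : (pt -> C) -> Prop :=
| rf_const (c : C) : regfun (fun _ => c)
| rf_a : regfun pa
| rf_b : regfun pb
| rf_x : regfun px
| rf_y : regfun py
| rf_add f g : regfun f -> regfun g -> regfun (fun p => f p + g p)
| rf_mul f g : regfun f -> regfun g -> regfun (fun p => f p * g p).

(* Regular (polynomial) maps Y -> Y. *)
Definition regular_map (F : pt -> pt) : Prop :=
  [/\ regfun (fun p => pa (F p)), regfun (fun p => pb (F p)),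
      regfun (fun p => px (F p)) & regfun (fun p => py (F p))].

(* Coordinatewise complex conjugation. *)
Definition conjpt (p : pt) : pt := Pt (pa p)^* (pb p)^* (px p)^* (py p)^*.

(* Antiholomorphic (antiregular) maps: complex conjugate of a regular map. *)
Definition antiregular (mu : pt -> pt) : Prop :=
  exists F, regular_map F /\ forall p, mu p = conjpt (F p).

(* Real circle form on Y (for the C^*-action with weights 2 and n). *)
Definition real_circle_form (n : nat) (mu : pt -> pt) : Prop :=
  [/\ antiregular mu, involutive mu &
      forall t : C, t != 0 -> forall p, mu (act n t p) = act n (sigma t) (mu p)].

(* Equivariant regular automorphisms and equivalence of real circle forms. *)
Definition equivariant (n : nat) (psi : pt -> pt) : Prop :=
  forall t : C, t != 0 -> forall p, psi (act n t p) = act n t (psi p).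

Definition equiv_rcf (n : nat) (mu1 mu2 : pt -> pt) : Prop :=
  exists psi psiinv : pt -> pt,
    [/\ regular_map psi, regular_map psiinv, cancel psi psiinv &
        cancel psiinv psi] /\ equivariant n psi /\
    forall p, mu2 p = psi (mu1 (psiinv p)).

(* mu_0(a,b,x,y) = (conj b, conj a, conj y, conj x). *)
Definition mu0 (p : pt) : pt := Pt (pb p)^* (pa p)^* (py p)^* (px p)^*.

(* phi_h(a,b,x,y) = (a, b, M_h (x,y)^T), with T = ab and h = h(ab). *)
Definition phi (n : nat) (h : {poly C}) (p : pt) : pt :=
  let T := pa p * pb p in
  let hv := h.[T] in
  Pt (pa p) (pb p)
     ((1 - T * hv ^+ 2) * px p + (pa p) ^+ n * hv ^+ n * py p)
     (- ((pb p) ^+ n * hv ^+ n) * px p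
        + (\sum_(j < n) (T * hv ^+ 2) ^+ j) * py p).

Definition muh (n : nat) (h : {poly C}) : pt -> pt := phi n h \o mu0.

End Defs.

(* Main.v *)
(* Along the fixed locus x = y = 0 of t = -1, an equivalence of the two forms
   induces an isomorphism N of the normal bundle over an automorphism
   (a, b) |-> (alpha a, conj(alpha) b) of W_2.  On the slice a = 1 the form mu_h
   becomes a Hermitian form over C[T] of determinant -T^n, and its lattice is
   identified with the sublattice {e + W o | o = -h e mod T^m} of C[W], W^2 = T,
   carrying the form |e|^2 - T |o|^2.  That form is anisotropic at T = 0 and at
   T = -oo, so N acts on the vectors T^m and T^m W by scalars u1, u2 of the same
   modulus, and preservation of the lattices means u1 k = u2 h mod T^m, where
   k(T) = |alpha| h'(|alpha|^2 T).  Conversely, a congruence h = k mod T^m makes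
   the two sublattices equal, and the change of basis is the wanted
   automorphism. *)
Require Import Defs.
From HB Require Import structures.
From Stdlib Require Import FunctionalExtensionality.
From mathcomp Require Import all_boot all_order all_algebra.
From mathcomp Require Import ring.
Set Implicit Arguments. Unset Strict Implicit. Unset Printing Implicit Defensive.
Import Order.TTheory GRing.Theory Num.Theory.
Local Open Scope ring_scope.

(** * Geometric sums and the polynomial identities behind the Hermitian form *)

Definition geom (R : comNzRingType) (m : nat) (x : R) : R := \sum_(i < m) x ^+ i.

Lemma geomSr (R : comNzRingType) m (x : R) : geom m.+1 x = geom m x + x ^+ m.
Proof. by rewrite /geom big_ord_recr. Qed.

Lemma geomSl (R : comNzRingType) m (x : R) : geom m.+1 x = 1 + x * geom m x.
Proof.
rewrite /geom big_ord_recl expr0; congr (_ + _); rewrite mulr_sumr.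
by apply: eq_bigr => i _; rewrite exprS.
Qed.

Lemma expr_geom (R : comNzRingType) m (x : R) :
  x ^+ m = 1 + x * geom m x - geom m x.
Proof. by rewrite -geomSl geomSr addrC addKr. Qed.

Lemma geom_double (R : comNzRingType) m (x : R) :
  geom (2 * m + 1) x = geom m.+1 x + x ^+ m.+1 * geom m x.
Proof.
have -> : (2 * m + 1 = m.+1 + m)%N by rewrite mul2n -addnn addn1 addSn.
rewrite /geom big_split_ord /= mulr_sumr; congr (_ + _).
by apply: eq_bigr => i _; rewrite exprD.
Qed.

Lemma expr_split (R : comNzRingType) m (T h : R) :
  T ^+ (2 * m + 1) * h ^+ (2 * m + 1) = T * h * T ^+ m * (T * h ^+ 2) ^+ m.
Proof. by rewrite exprMn -(exprM h) !addn1 !(exprS _ (2 * m)) mul2n -addnn !exprD; ring. Qed.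

Lemma odd_expr (R : comNzRingType) m (T : R) :
  T ^+ (2 * m + 1) = T * T ^+ m * T ^+ m.
Proof. by rewrite addn1 exprS mul2n -addnn exprD mulrA. Qed.

(* Over [C[W]] with [W^2 = T] the form splits as [L(W) L(-W)]; here [y - al x]
   and [be x - h y] are the even and odd parts of [L]. *)
Lemma form_split (R : comNzRingType) m (T h x y x' y' : R) :
  let n := (2 * m + 1)%N in let X := T * h ^+ 2 in
  let al := T ^+ m.+1 * h * geom m X in let be := T ^+ m * geom m.+1 X in
  (y - al * x) * (y' - al * x') - T * ((be * x - h * y) * (be * x' - h * y')) =
  (1 - T * h ^+ 2) * (y * y') + T ^+ n * h ^+ n * (x * y' + x' * y)
  - T ^+ n * geom n X * (x * x').
Proof.
rewrite /= expr_split geom_double !exprS.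
rewrite geomSl (expr_geom m (T * _)) odd_expr; ring.
Qed.

(** The conjugates of [p], [q], [r], [s], [w], [x], [y] enter as independent primed letters, so this
    is a pure ring identity. The hypotheses say entrywise that the matrix with rows [(p, q)] and
    [(Tn r, s)] intertwines two semilinear maps. Pairing them with [u'] and [v'] leaves the
    determinant of the conjugate matrix as scaling factor, by Cramer's rule. *)
Lemma form_transfer (R : comNzRingType)
    (Tn A A' H K S S' w w' p q r s p' q' r' s' x y x' y' : R) :
  p' * A - Tn * q' * H = A' * s + Tn * w' * K * q ->
  p' * H + q' * S = A' * r + w' * K * p ->
  r' * A - s' * H = - (w * K * s) + S' * q ->
  Tn * r' * H + s' * S = - (Tn * w * K * r) + S' * p ->
  let u := p * x + q * y in let v := Tn * r * x + s * y in
  let u' := p' * x' + q' * y' in let v' := Tn * r' * x' + s' * y' in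
  A' * (v * v') + Tn * K * (w' * u * v' + w * u' * v) - Tn * S' * (u * u') =
  (p' * s' - Tn * q' * r') *
     (A * (y * y') + Tn * H * (x * y' + x' * y) - Tn * S * (x * x')).
Proof.
move=> c1 c2 c3 c4 /=.
set u := p * x + q * y; set v := Tn * r * x + s * y.
have f1 : A' * v + Tn * K * w' * u =
   y * (p' * A - Tn * q' * H) + Tn * x * (p' * H + q' * S).
  by rewrite c1 c2 /u /v; ring.
have f2 : w * K * v - S' * u = - y * (r' * A - s' * H) - x * (Tn * r' * H + s' * S).
  by rewrite c3 c4 /u /v; ring.
transitivity ((Tn * r' * x' + s' * y') * (A' * v + Tn * K * w' * u)
   + (p' * x' + q' * y') * Tn * (w * K * v - S' * u)); first by ring.
rewrite f1 f2; ring.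
Qed.

(** * The Hermitian form over C[T] *)

Section Conj.
Variable C : numClosedFieldType.
Implicit Types (P Q e o h k p q r s : {poly C}).

Definition cpoly P : {poly C} := map_poly Num.conj P.

HB.instance Definition _ := GRing.RMorphism.copy cpoly (map_poly Num.conj).

Lemma horner_cpoly P z : (cpoly P).[z] = (P.[z^*])^*.
Proof. by rewrite -{1}[z]conjCK horner_map. Qed.

Lemma cpolyM P Q : cpoly (P * Q) = cpoly P * cpoly Q.
Proof. exact: rmorphM. Qed.

Lemma cpolyD P Q : cpoly (P + Q) = cpoly P + cpoly Q.
Proof. exact: rmorphD. Qed.

Lemma cpolyN P : cpoly (- P) = - cpoly P.
Proof. exact: rmorphN. Qed.

Lemma cpoly1 : cpoly 1 = 1.
Proof. exact: rmorph1. Qed.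

Lemma cpolyXn P n : cpoly (P ^+ n) = cpoly P ^+ n.
Proof. exact: rmorphXn. Qed.

Lemma cpolyC c : cpoly c%:P = (c^*)%:P.
Proof. exact: map_polyC. Qed.

Lemma cpolyX : cpoly 'X = 'X.
Proof. exact: map_polyX. Qed.

Lemma cpolyK : involutive cpoly.
Proof. by move=> P; apply/polyP=> i; rewrite /cpoly !coef_map /= conjCK. Qed.

Lemma cpoly_real P : P \is a polyOver Num.real -> cpoly P = P.
Proof. by move/polyOverP=> Pr; apply/polyP=> i; rewrite coef_map /= conj_Creal. Qed.

Lemma size_cpoly P : size (cpoly P) = size P.
Proof. exact: size_map_poly. Qed.

Lemma cpoly_eq0 P : (cpoly P == 0) = (P == 0).
Proof. exact: map_poly_eq0. Qed.

Lemma norm_root0 e o j c : e * cpoly e - 'X * (o * cpoly o) = c *: 'X^(j.+1) ->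
  exists e', e = 'X * e'.
Proof.
move=> H; have : root e 0.
  have := congr1 (fun P => P.[0]) H.
  rewrite !(hornerE, hornerXn) horner_cpoly conjC0 exprS !mul0r mulr0 subr0.
  by move/eqP; rewrite mul_conjC_eq0.
by move/factor_theorem=> [e' ->]; exists e'; rewrite subr0 mulrC.
Qed.

(* The form [|e|^2 - T |o|^2] is anisotropic at [T = 0] and at [T = -oo]
   because its two terms have degrees and valuations of distinct parity. *)
Lemma norm_form_eq_monomial m c e o : c != 0 ->
  e * cpoly e - 'X * (o * cpoly o) = c *: 'X^(2 * m) ->
  o = 0 /\ exists u, e = u *: 'X^m /\ u * u^* = c.
Proof.
move=> c0; elim: m e o => [|m IH] e o.
  rewrite muln0 expr0 => H.
  (* Sizes exceed degrees by one: the first term has odd size and the second even size, at least 2,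
     so no cancellation can bring the difference down to a constant. *)
  have o0 : o = 0.
    apply/eqP/negPn/negP=> on0.
    have so : size ('X * (o * cpoly o)) = (size o).*2.
      have oo0 : o * cpoly o != 0 by rewrite mulf_neq0 // cpoly_eq0.
      rewrite mulrC size_mulX // size_mul ?cpoly_eq0 // size_cpoly addnn prednK //.
      by rewrite double_gt0 size_poly_gt0.
    have sop : (1 < (size o).*2)%N.
      by rewrite -size_poly_gt0 in on0; case: (size o) on0.
    have [e0|en0] := eqVneq e 0.
      have := congr1 (fun P : {poly C} => size P) H.
      rewrite e0 mul0r sub0r size_polyN so alg_polyC => E.
      by have := size_polyC_leq1 c; rewrite -E leqNgt sop.
    have se : size (e * cpoly e) = (size e).*2.-1.
      by rewrite size_mul ?cpoly_eq0 // size_cpoly addnn.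
    have sep : (0 < size e)%N by rewrite size_poly_gt0.
    have := size_polyC_leq1 c; rewrite -alg_polyC -H.
    have [lt|gt|eq] := ltngtP (size (e * cpoly e)) (size ('X * (o * cpoly o))).
    - by rewrite addrC size_polyDl ?size_polyN // so leqNgt sop.
    - rewrite size_polyDl ?size_polyN //.
      by rewrite leqNgt (ltn_trans sop) // -so.
    - move: eq; rewrite se so => /(congr1 odd); rewrite odd_double.
      by case: (size e) sep => // a _; rewrite doubleS /= odd_double.
  split=> //; move: H; rewrite o0 mul0r mulr0 subr0 => H.
  have : size (e * cpoly e) = 1 by rewrite H alg_polyC size_polyC c0.
  have en0 : e != 0.
    by apply: contra_neq c0 => e0; move: H; rewrite e0 mul0r alg_polyC => /esym/eqP; rewrite polyC_eq0 => /eqP.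
  rewrite size_mul ?cpoly_eq0 // size_cpoly addnn => se.
  have /eqP/size_poly1P[u _ eu] : size e = 1.
    by move: se; case: (size e) => [|[|a]] //; rewrite !doubleS.
  exists u; rewrite alg_polyC eu; split=> //.
  by apply/polyC_inj; rewrite -(alg_polyC c) -H eu cpolyC polyCM.
rewrite mulnS !exprS => H.
(* Evaluation at [T = 0] gives [e(0) = 0]. Dividing by [T] exchanges the two components and negates
   [c]; doing so twice lowers [m] by one. *)
have [e1 e1E] : exists e1, e = 'X * e1 by apply: (@norm_root0 _ o (2 * m).+1 c); rewrite H !exprS.
have Xn0 : 'X != 0 :> {poly C} by rewrite polyX_eq0.
have H1 : o * cpoly o - 'X * (e1 * cpoly e1) = (- c) *: ('X * 'X^(2 * m)).
  apply: (mulfI Xn0); rewrite -[LHS]opprK scaleNr mulrN -scalerAr -H e1E rmorphM /= cpolyX.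
  by congr (- _); ring.
have [o1 o1E] : exists o1, o = 'X * o1.
  by apply: (@norm_root0 _ e1 (2 * m) (- c)); rewrite H1 !exprS.
have [|o10 [u [e1u uc]]] := IH e1 o1.
  apply: (mulfI Xn0); rewrite -[RHS]opprK -scalerAr -scaleNr -H1 o1E rmorphM /= cpolyX; ring.
split; first by rewrite o1E o10 mulr0.
by exists u; split=> //; rewrite e1E e1u scalerAr.
Qed.

(** One division by [T] exchanges [e] and [o] and reduces the odd exponent to the even case. *)
Lemma norm_form_eq_monomialX m c e o : c != 0 ->
  e * cpoly e - 'X * (o * cpoly o) = - c *: 'X^((2 * m).+1) ->
  e = 0 /\ exists u, o = u *: 'X^m /\ u * u^* = c.
Proof.
move=> c0 H; have [e1 e1E] := norm_root0 H.
have Xn0 : 'X != 0 :> {poly C} by rewrite polyX_eq0.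
have [|e0 ou] := @norm_form_eq_monomial m c o e1 c0.
  apply: (mulfI Xn0); rewrite -scalerAr -exprS -[RHS]opprK -scaleNr -H e1E rmorphM /= cpolyX; ring.
by split=> //; rewrite e1E e0 mulr0.
Qed.

Lemma cpoly_geom m P : cpoly (geom m P) = geom m (cpoly P).
Proof. by rewrite /geom rmorph_sum; apply: eq_bigr => i _; rewrite rmorphXn. Qed.

Lemma cpoly_comp P Q : cpoly (P \Po Q) = cpoly P \Po cpoly Q.
Proof. exact: map_comp_poly. Qed.

Definition cpolyE :=
  (cpolyD, cpolyN, cpolyM, cpolyXn, cpoly1, cpolyC, cpolyX, cpoly_geom, cpolyK).

Lemma dvdp_cpoly P p : (cpoly P %| cpoly p) = (P %| p).
Proof. exact: dvdp_map. Qed.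

(** Since [h] and [k] are real, conjugating the congruence gives a second one. If [u1 / u2] is real,
    it is a sign because the moduli agree; otherwise the two congruences are independent, and [h]
    and [k] both vanish modulo [T^m]. *)
Lemma eq_up_to_sign m h k (u1 u2 : C) :
  cpoly h = h -> cpoly k = k -> u1 != 0 -> u1 * u1^* = u2 * u2^* ->
  'X^m %| u1 *: k - u2 *: h ->
  exists2 e : C, e = 1 \/ e = -1 & 'X^m %| h - e *: k.
Proof.
move=> hr kr u10 u12 d.
have c0 : u2 * u2^* != 0 by rewrite -u12 mul_conjC_eq0.
have u20 : u2 != 0 by rewrite -mul_conjC_eq0.
have d' : 'X^m %| u1^* *: k - u2^* *: h.
  rewrite -dvdp_cpoly rmorphXn /= cpolyX rmorphB /= -!mul_polyC !rmorphM /= !cpolyC.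
  by rewrite !conjCK hr kr !mul_polyC.
have [re|nre] := eqVneq (u1^* * u2) (u1 * u2^*).
  exists (u1 * u2^* / (u2 * u2^*)).
    have /eqP : (u1 * u2^* / (u2 * u2^*)) ^+ 2 = 1.
      rewrite expr2 mulf_div -{1}re; apply: (canLR (mulfK _)); first by rewrite mulf_neq0.
      rewrite mul1r -{1}u12; ring.
    by rewrite sqrf_eq1 => /orP[] /eqP->; [left|right].
  rewrite -(dvdpZr _ _ u20) scalerBr scalerA -dvdpNr opprB.
  suff -> : u2 * (u1 * u2^* / (u2 * u2^*)) = u1 by [].
  by rewrite mulrA mulrCA -mulrA divff ?mulr1.
have dh : 'X^m %| h.
  rewrite -(@dvdpZr _ (u1^* * u2 - u1 * u2^*)) ?subr_eq0 //.
  have -> : (u1^* * u2 - u1 * u2^*) *: h =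
      u1 *: (u1^* *: k - u2^* *: h) - u1^* *: (u1 *: k - u2 *: h).
    by rewrite !scalerBr !scalerA scalerBl (mulrC u1^* u1); ring.
  by rewrite dvdp_sub // dvdpZr // conjC_eq0.
exists 1; [by left | rewrite scale1r dvdp_sub // -(dvdpZr _ _ u10)].
by move: d; rewrite dvdp_subl // dvdpZr.
Qed.

(** In the coordinates [(e, o)] of [C[W]] the images of [T^m] and [T^m W] have monomial norm, hence
    are [u1 T^m] and [u2 T^m W]. They determine the image of the basis vector [(0, 1)], which must
    lie in the lattice of [k]; this gives [u1 k = u2 h] modulo [T^m]. *)
Lemma intertwiner_congruence m h k p q r s (w c : C) :
  let n := (2 * m + 1)%N in
  cpoly h = h -> cpoly k = k -> w * w^* = 1 -> c != 0 ->
  p * s - 'X^n * q * r = c%:P ->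
  cpoly p * (1 - 'X * h ^+ 2) - 'X^n * cpoly q * h ^+ n
    = (1 - 'X * k ^+ 2) * s + 'X^n * (w^*)%:P * k ^+ n * q ->
  cpoly p * h ^+ n + cpoly q * geom n ('X * h ^+ 2)
    = (1 - 'X * k ^+ 2) * r + (w^*)%:P * k ^+ n * p ->
  cpoly r * (1 - 'X * h ^+ 2) - cpoly s * h ^+ n
    = - (w%:P * k ^+ n * s) + geom n ('X * k ^+ 2) * q ->
  'X^n * cpoly r * h ^+ n + cpoly s * geom n ('X * h ^+ 2)
    = - ('X^n * w%:P * k ^+ n * r) + geom n ('X * k ^+ 2) * p ->
  exists2 e : C, e = 1 \/ e = -1 & 'X^m %| h - e *: k.
Proof.
move=> n hr kr ww c0 D c1 c2 c3 c4.
have tr x y x' y' := form_transfer x y x' y' c1 c2 c3 c4.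
have D' : cpoly p * cpoly s - 'X^n * cpoly q * cpoly r = (c^*)%:P.
  by rewrite -cpolyC -D rmorphB !rmorphM /= rmorphXn /= cpolyX.
have c0' : c^* != 0 by rewrite conjC_eq0.
(* The coefficients of [form_split]: a vector [(x, y)] of the lattice of [P] has even part
   [y - al P x] and odd part [be P x - P y], a change of coordinates of determinant [-T^m] by
   [be_al]. *)
pose al P : {poly C} := 'X^(m.+1) * P * geom m ('X * P ^+ 2).
pose be P : {poly C} := 'X^m * geom m.+1 ('X * P ^+ 2).
have al_r P : cpoly P = P -> cpoly (al P) = al P.
  by move=> Pr; rewrite /al !rmorphM /= !rmorphXn /= cpoly_geom rmorphM rmorphXn /= cpolyX Pr.
have be_r P : cpoly P = P -> cpoly (be P) = be P.
  by move=> Pr; rewrite /be !rmorphM /= !rmorphXn /= cpoly_geom rmorphM rmorphXn /= cpolyX Pr.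
have be_al P : be P - P * al P = 'X^m.
  by rewrite /be /al geomSl (exprS 'X m); ring.
pose u x y := p * x + q * y.
pose v x y := 'X^n * r * x + s * y.
(* Even and odd parts of the image vector in the lattice of [k]. The conjugate phase on [u] absorbs
   [w] from the off-diagonal terms of the target form. *)
pose e x y := v x y - al k * ((w^*)%:P * u x y).
pose o x y := be k * ((w^*)%:P * u x y) - k * v x y.
have wwP : (w^*)%:P * w%:P = 1 :> {poly C} by rewrite -polyCM mulrC ww.
have norm x y : cpoly x = x -> cpoly y = y ->
    e x y * cpoly (e x y) - 'X * (o x y * cpoly (o x y)) =
    (c^*)%:P * ((y - al h * x) ^+ 2 - 'X * (be h * x - h * y) ^+ 2).
  move=> xr yr; rewrite !expr2 (form_split m 'X h x y x y) -D'.
  have := tr x y x y; rewrite -[2%N]/(1 + 1)%N /= -/(u x y) -/(v x y) => <-.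
  have -> : cpoly (e x y) = cpoly (v x y) - al k * (w%:P * cpoly (u x y)).
    by rewrite /e rmorphB /= cpolyM al_r // cpolyM cpolyC conjCK.
  have -> : cpoly (o x y) = be k * (w%:P * cpoly (u x y)) - k * cpoly (v x y).
    by rewrite /o rmorphB /= cpolyM be_r // cpolyM cpolyC conjCK cpolyM kr.
  rewrite (form_split m 'X k).
  have -> : cpoly (u x y) = cpoly p * x + cpoly q * y.
    by rewrite /u rmorphD !rmorphM /= xr yr.
  have -> : cpoly (v x y) = 'X^n * cpoly r * x + cpoly s * y.
    by rewrite /v rmorphD !rmorphM /= rmorphXn /= cpolyX xr yr.
  rewrite -/n; congr (_ + _ - _ * _).
  by rewrite mulrACA wwP mul1r.
(* The vector [(h, be h)] has even part [T^m] and odd part 0: it represents [T^m]. *)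
have [o1 [u1 [e1 cu1]]] : o h (be h) = 0 /\
    exists u1, e h (be h) = u1 *: 'X^m /\ u1 * u1^* = c^*.
  apply: norm_form_eq_monomial c0' _; rewrite norm ?be_r // -mul_polyC mulnC exprM.
  by rewrite (mulrC (al h)) be_al (mulrC h) subrr expr0n mulr0 subr0.
(* The vector [(1, al h)] has even part 0 and odd part [T^m]: it represents [T^m W]. *)
have [e2 [u2 [o2 cu2]]] : e 1 (al h) = 0 /\
    exists u2, o 1 (al h) = u2 *: 'X^m /\ u2 * u2^* = c^*.
  apply: norm_form_eq_monomialX c0' _; rewrite norm ?al_r // ?rmorph1 // -mul_polyC.
  rewrite (exprS _ (2 * m)) (mulnC 2) (exprM 'X) -(be_al h) polyCN; ring.
have Xm0 : 'X^m != 0 :> {poly C} by rewrite -size_poly_eq0 size_polyXn.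
(* Cancel [T^m] in the image of [T^m (0, 1) = (h, be h) - h (1, al h)]. *)
have e0 : e 0 1 = u1%:P.
  have : 'X^m * e 0 1 = e h (be h) - h * e 1 (al h).
    by rewrite -(be_al h) /e /u /v; ring.
  by rewrite e1 e2 mulr0 subr0 -mul_polyC [RHS]mulrC => /(mulfI Xm0).
have o0 : o 0 1 = - h * u2%:P.
  have : 'X^m * o 0 1 = o h (be h) - h * o 1 (al h).
    by rewrite -(be_al h) /o /u /v; ring.
  by rewrite o1 o2 sub0r -mulNr -mul_polyC mulrA [RHS]mulrC => /(mulfI Xm0).
apply: (@eq_up_to_sign m h k u1 u2) => //; last 2 first.
- by rewrite cu1.
(* At [(0, 1)], the sum [k e + o] is a multiple of [q] by [be k - k al k = T^m]. *)
- have -> : u1 *: k - u2 *: h = 'X^m * ((w^*)%:P * q).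
    rewrite -!mul_polyC -e0 -(be_al k).
    have -> : u2%:P * h = - o 0 1 by rewrite o0; ring.
    by rewrite /e /o /u /v; ring.
  by rewrite dvdp_mulr.
by rewrite -mul_conjC_eq0 cu1.
Qed.

End Conj.

(** * Block maps and explicit equivalences *)

Section Maps.
Variable C : numClosedFieldType.
Implicit Types (h k p q r s : {poly C}) (u v : pt C).

Definition swap u : pt C := Pt (pb u) (pa u) (py u) (px u).

(** The factors [a^n] and [b^n] supply the weights that equivariance requires off the diagonal. As
    [a^n b^n = T^n], composition is the product of matrices with rows [(p, q)] and [(T^n r, s)]. *)
Definition blockmap (n : nat) p q r s u : pt C :=
  let T := pa u * pb u in
  Pt (pa u) (pb u) (p.[T] * px u + pa u ^+ n * q.[T] * py u)
    (pb u ^+ n * r.[T] * px u + s.[T] * py u).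

Lemma horner_geom n p (z : C) : (geom n p).[z] = geom n p.[z].
Proof. by rewrite horner_sum; apply: eq_bigr => i _; rewrite horner_exp. Qed.

Lemma blockmap_comp n p q r s p' q' r' s' u :
  blockmap n p q r s (blockmap n p' q' r' s' u) =
  blockmap n (p * p' + 'X^n * q * r') (p * q' + q * s')
    (r * p' + s * r') ('X^n * r * q' + s * s') u.
Proof.
by rewrite /blockmap /= !(hornerE, hornerXn) !exprMn; congr Pt; ring.
Qed.

Lemma blockmap_id n u : blockmap n 1 0 0 1 u = u.
Proof.
by case: u => a b x y; rewrite /blockmap /= !(hornerE, mulr0, mul0r, addr0, add0r).
Qed.

Lemma mu0_blockmap n p q r s u :
  mu0 (blockmap n p q r s u) =
  blockmap n (cpoly s) (cpoly r) (cpoly q) (cpoly p) (mu0 u).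
Proof.
rewrite /mu0 /blockmap /= !horner_cpoly !rmorphD /= !rmorphM /= !rmorphXn /= !conjCK.
by rewrite [pb u * pa u]mulrC; congr Pt; rewrite addrC.
Qed.

Lemma conj_blockmap n p q r s u :
  conjpt (blockmap n p q r s u) =
  blockmap n (cpoly p) (cpoly q) (cpoly r) (cpoly s) (conjpt u).
Proof.
by rewrite /conjpt /blockmap /= !horner_cpoly !rmorphD /= !rmorphM /= !rmorphXn /= !conjCK.
Qed.

Lemma mu0K : involutive (@mu0 C).
Proof. by case=> a b x y; rewrite /mu0 /= !conjCK. Qed.

Lemma phi_blockmap n h u :
  phi n h u =
  blockmap n (1 - 'X * h ^+ 2) (h ^+ n) (- h ^+ n) (geom n ('X * h ^+ 2)) u.
Proof.
rewrite /phi /blockmap horner_geom !(hornerE, horner_exp); congr Pt.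
by rewrite mulrN.
Qed.

Lemma regfun_exp (f : pt C -> C) n : regfun f -> regfun (fun u => f u ^+ n).
Proof.
move=> Hf; elim: n => [|n IH]; first exact: rf_const.
have := rf_mul Hf IH; congr regfun.
by apply: functional_extensionality => u; rewrite exprS.
Qed.

Lemma regfun_horner (f : pt C -> C) p : regfun f -> regfun (fun u => p.[f u]).
Proof.
move=> Hf; elim/poly_ind: p => [|p c IH].
  have := rf_const (0 : C); congr regfun.
  by apply: functional_extensionality => u; rewrite horner0.
have := rf_add (rf_mul IH Hf) (rf_const c); congr regfun.
by apply: functional_extensionality => u; rewrite !hornerE.
Qed.

Lemma regfun_comp (f : pt C -> C) G :
  regfun f -> regular_map G -> regfun (fun u => f (G u)).
Proof.
move=> Hf [ga gb gx gy]; elim: Hf => //= [c|f1 f2 _ H1 _ H2|f1 f2 _ H1 _ H2].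
- exact: rf_const.
- exact: rf_add.
- exact: rf_mul.
Qed.

Lemma regular_comp F G :
  regular_map F -> regular_map G -> regular_map (fun u => F (G u) : pt C).
Proof.
move=> [fa fb fx fy] gR; split.
- exact: regfun_comp fa gR.
- exact: regfun_comp fb gR.
- exact: regfun_comp fx gR.
- exact: regfun_comp fy gR.
Qed.

Lemma regular_blockmap n p q r s : regular_map (blockmap n p q r s).
Proof.
have HT P : regfun (fun u : pt C => P.[pa u * pb u]).
  by exact: regfun_horner (rf_mul (rf_a C) (rf_b C)).
split=> /=; [exact: rf_a | exact: rf_b | |].
  apply: rf_add (rf_mul (HT p) (rf_x C)) (rf_mul (rf_mul _ (HT q)) (rf_y C)).
  exact: regfun_exp (rf_a C).
apply: rf_add (rf_mul (rf_mul _ (HT r)) (rf_x C)) (rf_mul (HT s) (rf_y C)).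
exact: regfun_exp (rf_b C).
Qed.

Lemma regular_phi n h : regular_map (phi n h).
Proof.
have := regular_blockmap n (1 - 'X * h ^+ 2) (h ^+ n) (- h ^+ n) (geom n ('X * h ^+ 2)).
congr regular_map; apply: functional_extensionality => u.
by rewrite phi_blockmap.
Qed.

Lemma regular_swap : regular_map swap.
Proof. by split; constructor. Qed.

Lemma equivariant_blockmap n p q r s : equivariant n (blockmap n p q r s).
Proof.
move=> t t0 u; rewrite /blockmap /act /=.
have -> : t ^+ 2 * pa u * (t ^- 2 * pb u) = pa u * pb u.
  by field.
have tn0 : t ^+ n != 0 by rewrite expf_neq0.
have -> : (t ^+ 2 * pa u) ^+ n = t ^+ n * t ^+ n * pa u ^+ n.
  by rewrite exprMn -exprM mul2n -addnn exprD.
have -> : (t ^- 2 * pb u) ^+ n = t ^- n * t ^- n * pb u ^+ n.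
  by rewrite exprMn -exprVn -exprM mul2n -addnn exprD exprVn.
by congr Pt; field.
Qed.

Lemma mu0_act n (t : C) u : mu0 (act n t u) = act n (sigma t) (mu0 u).
Proof.
rewrite /mu0 /act /sigma /= !rmorphM /= !fmorphV /= !rmorphXn /= !exprVn !invrK.
by [].
Qed.

Lemma cpoly_torus h : cpoly h = h -> cpoly ('X * h ^+ 2) = 'X * h ^+ 2.
Proof. by move=> hr; rewrite rmorphM rmorphXn /= cpolyX hr. Qed.

Lemma conj_phi n h u : cpoly h = h -> conjpt (phi n h u) = phi n h (conjpt u).
Proof.
move=> hr; rewrite !phi_blockmap conj_blockmap.
by rewrite rmorphB rmorphN /= !rmorphXn /= cpoly_geom cpoly_torus // rmorph1 hr.
Qed.

(** For the involution: as [h] is real, conjugation by [mu0] turns [M_h] into its adjugate, and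
    [det M_h = 1] by the geometric sum. *)
Lemma muh_rcf m h (n := (2 * m + 1)%N) : cpoly h = h ->
  real_circle_form n (muh n h).
Proof.
move=> hr; split.
- exists (fun u => phi n h (swap u)); split.
    exact: regular_comp (regular_phi n h) regular_swap.
  by move=> u; rewrite conj_phi.
- move=> u; rewrite /muh /= !phi_blockmap mu0_blockmap mu0K blockmap_comp.
  rewrite rmorphB rmorphN /= !rmorphXn /= cpoly_geom cpoly_torus // rmorph1 hr.
  rewrite -[RHS](blockmap_id n).
  have geo : geom n ('X * h ^+ 2) * (1 - 'X * h ^+ 2) = 1 - 'X^n * h ^+ n * h ^+ n.
    have -> : 'X^n * h ^+ n * h ^+ n = ('X * h ^+ 2) ^+ n.
      by rewrite exprMn -exprM mul2n -addnn exprD mulrA.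
    by rewrite (expr_geom n); ring.
  congr (blockmap n _ _ _ _ u); [|ring|ring|].
    by rewrite mulrC geo; ring.
  by rewrite geo; ring.
- move=> t t0 u; rewrite /muh /= mu0_act !phi_blockmap equivariant_blockmap //.
  by rewrite invr_eq0 conjC_eq0.
Qed.

Lemma equiv_rcf_trans n mu1 mu2 mu3 :
  @equiv_rcf C n mu1 mu2 -> equiv_rcf n mu2 mu3 -> equiv_rcf n mu1 mu3.
Proof.
move=> [f [fi [[fr fir fK fiK] [fe fmu]]]] [g [gi [[gr gir gK giK] [ge gmu]]]].
exists (fun u => g (f u)), (fun u => fi (gi u)); split; [split | split].
- exact: regular_comp.
- exact: regular_comp.
- by move=> u; rewrite gK fK.
- by move=> u; rewrite fiK giK.
- by move=> t t0 u; rewrite fe // ge.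
- by move=> u; rewrite gmu fmu.
Qed.

(** Scaling [(a, b)] by a real [rho] commutes with [mu0], multiplies [T] by [rho^2] and [a^n] by
    [rho^n]. *)
Lemma equiv_rescale n h (rho : C) : rho \is Num.real -> rho != 0 ->
  equiv_rcf n (muh n (rho *: (h \Po (rho ^+ 2 *: 'X)))) (muh n h).
Proof.
move=> /CrealP rr r0.
pose sc (z : C) u : pt C := Pt (z * pa u) (z * pb u) (px u) (py u).
have scr z : regular_map (sc z).
  split=> /=; [| | exact: rf_x | exact: rf_y].
    exact: rf_mul (rf_const z) (rf_a C).
  exact: rf_mul (rf_const z) (rf_b C).
exists (sc rho), (sc rho^-1); split; [split=> // | split].
- by case=> a b x y; rewrite /sc /= !mulKf.
- by case=> a b x y; rewrite /sc /= !mulVKf.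
- by move=> t t0 [a b x y]; rewrite /sc /act /=; congr Pt; rewrite mulrCA.
move=> u; have {1}-> : u = sc rho (sc rho^-1 u).
  by case: u => a b x y; rewrite /sc /= !mulVKf.
case: (sc rho^-1 u) => a b x y; rewrite /muh /sc /phi /=.
rewrite !rmorphM /= rr !hornerZ !horner_comp !hornerZ !hornerX.
set z := b^*; set w := a^*.
have -> : rho * z * (rho * w) = rho ^+ 2 * (z * w) by ring.
set H := h.[_].
have -> : rho ^+ 2 * (z * w) * H ^+ 2 = z * w * (rho * H) ^+ 2 by ring.
by rewrite !exprMn; congr Pt; ring.
Qed.

Lemma dvdp_geomB n p q : p - q %| geom n p - geom n q.
Proof.
elim: n => [|n IH]; first by rewrite /geom !big_ord0 subrr dvdp0.
rewrite !geomSr.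
have -> : geom n p + p ^+ n - (geom n q + q ^+ n) =
  (geom n p - geom n q) + (p ^+ n - q ^+ n) by ring.
by rewrite dvdp_add // subrXX dvdp_mulr.
Qed.

(** The intertwiner is the change of basis [L_k^-1 L_h], where [L_h] sends [(x, y)] to its even and
    odd parts as in [form_split]. Both determinants are [-T^m], and the congruence makes the
    quotients by [T^m] polynomial. *)
Lemma equiv_congruent m h k (n := (2 * m + 1)%N) :
  cpoly h = h -> cpoly k = k -> 'X^m %| k - h -> equiv_rcf n (muh n h) (muh n k).
Proof.
move=> hr kr /[dup] hk /dvdpP[q]; rewrite mulrC => /esym R3.
have Xm0 : 'X^m != 0 :> {poly C} by rewrite -size_poly_eq0 size_polyXn.
set xh := 'X * h ^+ 2; set xk := 'X * k ^+ 2.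
pose sh := geom m xh; pose sk := geom m xk.
(* Lower left entry of [L_k^-1 L_h], with [T^n] taken out. Modulo [T^m], [h = k] makes the geometric
   sums equal, so the right side vanishes. *)
have [r R4] : exists r,
    'X^m * r = k * sk * (1 + xh * sh) - h * (1 + xk * sk) * sh.
  have /dvdpP[r rE] : 'X^m %| k * sk * (1 + xh * sh) - h * (1 + xk * sk) * sh.
    have dg j : 'X^m %| geom j xk - geom j xh.
      apply: dvdp_trans (dvdp_geomB j xk xh); apply: dvdp_trans hk _.
      have -> : xk - xh = (k - h) * ('X * (k + h)) by rewrite /xk /xh; ring.
      exact: dvdp_mulr.
    rewrite /sh /sk -!geomSl.
    set a := geom m.+1 xh; set b := geom m.+1 xk; set c := geom m xh; set d := geom m xk.
    have -> : k * d * a - h * b * c = (k - h) * (d * a) + h * a * (d - c) - h * c * (b - a).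
      by ring.
    apply: dvdp_sub; last exact/dvdp_mull/dg.
    by apply: dvdp_add; [exact: dvdp_mulr | exact/dvdp_mull/dg].
  by exists r; rewrite rE mulrC.
(* Diagonal entries [(be_h - k al_h) / T^m] and [(be_k - h al_k) / T^m]. *)
pose p := 1 + xh * sh - 'X * k * h * sh.
pose s := 1 + xk * sk - 'X * k * h * sk.
have shr : cpoly sh = sh by rewrite cpoly_geom cpoly_torus.
have skr : cpoly sk = sk by rewrite cpoly_geom cpoly_torus.
have xhr : cpoly xh = xh by rewrite cpoly_torus.
have xkr : cpoly xk = xk by rewrite cpoly_torus.
have pr : cpoly p = p.
  by rewrite rmorphB rmorphD /= rmorph1 (cpolyM xh) (cpolyM _ sh) !(cpolyM _ h) cpolyM xhr shr cpolyX hr kr.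
have sr : cpoly s = s.
  by rewrite rmorphB rmorphD /= rmorph1 (cpolyM xk) (cpolyM _ sk) !(cpolyM _ h) cpolyM xkr skr cpolyX hr kr.
have qr : cpoly q = q.
  apply: (mulfI Xm0); rewrite R3; have := congr1 (@cpoly C) R3.
  by rewrite cpolyM rmorphXn /= cpolyX rmorphB /= hr kr.
have r_r : cpoly r = r.
  apply: (mulfI Xm0); rewrite R4; have := congr1 (@cpoly C) R4.
  rewrite cpolyM rmorphXn /= cpolyX => ->.
  by rewrite rmorphB /= (cpolyM (k * sk)) (cpolyM k) (cpolyM (h * _)) (cpolyM h) !rmorphD /= (cpolyM xh) (cpolyM xk) rmorph1 xhr xkr shr skr hr kr.
(* Powers and long geometric sums are reduced to [sh] and [sk], so that the intertwining relations
   [E1] to [E4] become ring identities. [E2] and [E3] are first multiplied by [T^m] to let [R3] and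
   [R4] apply. *)
have R1 : 'X^m * h ^+ m * h ^+ m = 1 + xh * sh - sh.
  by rewrite -expr_geom exprMn -exprM mul2n -addnn exprD mulrA.
have R2 : 'X^m * k ^+ m * k ^+ m = 1 + xk * sk - sk.
  by rewrite -expr_geom exprMn -exprM mul2n -addnn exprD mulrA.
have gh : geom n xh = (1 + xh * sh) + (1 + xh * sh - sh) * xh * sh.
  by rewrite geom_double geomSl exprS (expr_geom m) -/sh; ring.
have gk : geom n xk = (1 + xk * sk) + (1 + xk * sk - sk) * xk * sk.
  by rewrite geom_double geomSl exprS (expr_geom m) -/sk; ring.
have det : p * s - 'X^n * q * r = 1.
  have -> : 'X^n * q * r = 'X * ('X^m * q) * ('X^m * r) by rewrite odd_expr; ring.
  by rewrite R3 R4 /p /s /xh /xk; ring.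
have E1 : p * (1 - xh) - 'X^n * q * h ^+ n = (1 - xk) * s + 'X^n * k ^+ n * q.
  have -> : 'X^n * q * h ^+ n = 'X * h * ('X^m * q) * ('X^m * h ^+ m * h ^+ m).
    by rewrite !odd_expr; ring.
  have -> : 'X^n * k ^+ n * q = 'X * k * ('X^m * q) * ('X^m * k ^+ m * k ^+ m).
    by rewrite !odd_expr; ring.
  by rewrite R1 R2 R3 /p /s /xh /xk; ring.
have E2 : p * h ^+ n + q * geom n xh = (1 - xk) * r + k ^+ n * p.
  apply: (mulfI Xm0); rewrite (mulrDr _ (p * _)) (mulrDr _ (_ * r)).
  have -> : 'X^m * (p * h ^+ n) = p * h * ('X^m * h ^+ m * h ^+ m).
    by rewrite odd_expr; ring.
  have -> : 'X^m * (k ^+ n * p) = p * k * ('X^m * k ^+ m * k ^+ m).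
    by rewrite odd_expr; ring.
  by rewrite (mulrA _ q) R1 R2 R3 (mulrCA _ _ r) R4 gh /p /xh /xk; ring.
have E3 : r * (1 - xh) - s * h ^+ n = - (k ^+ n * s) + geom n xk * q.
  apply: (mulfI Xm0); rewrite (mulrBr _ (r * _)) (mulrDr _ (- _)) (mulrN 'X^m).
  have -> : 'X^m * (s * h ^+ n) = s * h * ('X^m * h ^+ m * h ^+ m).
    by rewrite odd_expr; ring.
  have -> : 'X^m * (k ^+ n * s) = s * k * ('X^m * k ^+ m * k ^+ m).
    by rewrite odd_expr; ring.
  by rewrite (mulrA _ r) R1 R2 R4 (mulrCA _ _ q) R3 gk /s /xh /xk; ring.
have E4 : 'X^n * r * h ^+ n + s * geom n xh = - ('X^n * k ^+ n * r) + geom n xk * p.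
  have -> : 'X^n * r * h ^+ n = 'X * h * ('X^m * r) * ('X^m * h ^+ m * h ^+ m).
    by rewrite !odd_expr; ring.
  have -> : 'X^n * k ^+ n * r = 'X * k * ('X^m * r) * ('X^m * k ^+ m * k ^+ m).
    by rewrite !odd_expr; ring.
  by rewrite R1 R2 R4 gh gk /p /s /xh /xk; ring.
have inv1 u : blockmap n s (- q) (- r) p (blockmap n p q r s u) = u.
  rewrite blockmap_comp -[RHS](blockmap_id n).
  congr (blockmap n _ _ _ _ u); [|ring|ring|]; rewrite -det; ring.
have inv2 u : blockmap n p q r s (blockmap n s (- q) (- r) p u) = u.
  rewrite blockmap_comp -[RHS](blockmap_id n).
  congr (blockmap n _ _ _ _ u); [|ring|ring|]; rewrite -det; ring.
exists (blockmap n p q r s), (blockmap n s (- q) (- r) p); split; [split=> // | split].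
- exact: regular_blockmap.
- exact: regular_blockmap.
- exact: equivariant_blockmap.
move=> u; rewrite -{1}[u]inv2; move: (blockmap n s (- q) (- r) p u) => v.
rewrite /muh /= !phi_blockmap mu0_blockmap !blockmap_comp pr qr r_r sr.
congr (blockmap n _ _ _ _ (mu0 v)).
- by rewrite -E1 /xh; ring.
- by rewrite -E2 /xh; ring.
- by rewrite -/xh mulrN E3 -/xk; ring.
- by rewrite -/xh E4 -/xk; ring.
Qed.

End Maps.

(** * Normal derivatives along x = y = 0 *)

Section Jets.
Variable C : numClosedFieldType.
Implicit Types (h k p q F A B X Y : {poly C}) (s : C) (u v j : pt C) (e : C -> C -> C).

Lemma poly_ext_neq0 p q : (forall z : C, z != 0 -> p.[z] = q.[z]) -> p = q.
Proof.
move=> H; apply/eqP; rewrite -subr_eq0; apply/negPn/negP => n0.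
(* The points 1, 2, 3, ... are nonzero and distinct in characteristic 0; their number is the size,
   one more than the degree. *)
pose rs := [seq i.+1%:R : C | i <- iota 0 (size (p - q))].
have rsP : all (root (p - q)) rs.
  apply/allP => _ /mapP[i _ ->]; rewrite /root hornerD hornerN H ?subrr //.
  by rewrite pnatr_eq0.
have rsU : uniq rs.
  rewrite map_inj_uniq ?iota_uniq // => a b /eqP.
  by rewrite eqr_nat eqSS => /eqP.
by have := max_poly_roots n0 rsP rsU; rewrite size_map size_iota ltnn.
Qed.

Lemma poly_ext p q : (forall z : C, p.[z] = q.[z]) -> p = q.
Proof. by move=> H; apply: poly_ext_neq0. Qed.

Lemma coef1M p q : (p * q)`_1 = p`_0 * q`_1 + p`_1 * q`_0.
Proof. by rewrite coefM big_ord_recl big_ord1. Qed.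

(** Stands for a polynomial in two variables through the property that slices use: its restriction
    to any polynomial curve is polynomial in the parameter. *)
Definition polyfun2 e := forall A B, exists F, forall t, e A.[t] B.[t] = F.[t].

Lemma polyfun2_const c : polyfun2 (fun _ _ => c).
Proof. by move=> A B; exists c%:P => t; rewrite hornerC. Qed.

Lemma polyfun2_add e e' :
  polyfun2 e -> polyfun2 e' -> polyfun2 (fun a b => e a b + e' a b).
Proof.
by move=> H H' A B; have [[F HF] [F' HF']] := (H A B, H' A B); exists (F + F') => t;
  rewrite hornerD HF HF'.
Qed.

Lemma polyfun2_mul e e' :
  polyfun2 e -> polyfun2 e' -> polyfun2 (fun a b => e a b * e' a b).
Proof.
by move=> H H' A B; have [[F HF] [F' HF']] := (H A B, H' A B); exists (F * F') => t;
  rewrite hornerM HF HF'.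
Qed.

(* The jet of a curve meeting [x = y = 0] at [s = 0] with no first-order motion in
   [(a, b)]: its base point together with its velocity in the normal directions. *)
Definition has_jet (c : C -> pt C) j := exists A B X Y,
  [/\ forall s, c s = Pt A.[s] B.[s] X.[s] Y.[s],
      A`_0 = pa j /\ A`_1 = 0, B`_0 = pb j /\ B`_1 = 0,
      X`_0 = 0 /\ X`_1 = px j & Y`_0 = 0 /\ Y`_1 = py j].

Definition ray j (s : C) : pt C := Pt (pa j) (pb j) (s * px j) (s * py j).

(** [J] is the map that [psi] induces on the normal bundle of [x = y = 0]. Testing on jets of curves
    makes the chain rule a mere composition. *)
Definition normal_map (psi J : pt C -> pt C) :=
  forall c j, has_jet c j -> has_jet (fun s => psi (c s)) (J j).

Lemma ray_jet j : has_jet (ray j) j.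
Proof.
exists (pa j)%:P, (pb j)%:P, (px j *: 'X), (py j *: 'X).
by split; [move=> s; rewrite /ray !hornerE ![s * _]mulrC | | | |];
  rewrite ?coefC ?coefZ ?coefX /= ?mulr0 ?mulr1.
Qed.

Lemma has_jet_ext c c' j : c =1 c' -> has_jet c j -> has_jet c' j.
Proof.
by move=> E [A [B [X [Y [H *]]]]]; exists A, B, X, Y; split=> // s; rewrite -E.
Qed.

Lemma has_jet_inj c j j' : has_jet c j -> has_jet c j' -> j = j'.
Proof.
move=> [A [B [X [Y [H [A0 _] [B0 _] [_ X1] [_ Y1]]]]]].
move=> [A' [B' [X' [Y' [H' [A0' _] [B0' _] [_ X1'] [_ Y1']]]]]].
have E s : Pt A.[s] B.[s] X.[s] Y.[s] = Pt A'.[s] B'.[s] X'.[s] Y'.[s].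
  by rewrite -H -H'.
have EA : A = A' by apply: poly_ext => s; case: (E s).
have EB : B = B' by apply: poly_ext => s; case: (E s).
have EX : X = X' by apply: poly_ext => s; case: (E s).
have EY : Y = Y' by apply: poly_ext => s; case: (E s).
move: A0 B0 X1 Y1; rewrite EA EB EX EY A0' B0' X1' Y1'.
by case: (j) => ????; case: (j') => ???? /= -> -> -> ->.
Qed.

Lemma normal_map_comp f J g K : normal_map f J -> normal_map g K ->
  normal_map (fun u => f (g u)) (fun u => J (K u)).
Proof. by move=> fJ gK c j /gK/fJ. Qed.

Lemma normal_map_inj f g J K : f =1 g -> normal_map f J -> normal_map g K -> J =1 K.
Proof.
move=> E fJ gK u; apply: has_jet_inj (gK _ _ (ray_jet u)).
by apply: has_jet_ext (fJ _ _ (ray_jet u)) => s; rewrite E.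
Qed.

(** Conjugating a curve together with its parameter keeps its coordinates polynomial. *)
Lemma normal_map_conj f J : normal_map f J ->
  normal_map (fun u => conjpt (f (conjpt u))) (fun u => conjpt (J (conjpt u))).
Proof.
have cj c j : has_jet c j -> has_jet (fun s => conjpt (c s^*)) (conjpt j).
  move=> [A [B [X [Y [H [A0 A1] [B0 B1] [X0 X1] [Y0 Y1]]]]]].
  exists (cpoly A), (cpoly B), (cpoly X), (cpoly Y); split;
    rewrite ?coef_map /= ?A0 ?A1 ?B0 ?B1 ?X0 ?X1 ?Y0 ?Y1 ?conjC0 //.
  by move=> s; rewrite !horner_cpoly H /conjpt.
move=> fJ c j /cj/fJ/cj; apply: has_jet_ext => s /=.
by rewrite conjCK.
Qed.

(** [e0] is the value of [f] on [x = y = 0], and [e1], [e2] are its derivatives in [x] and [y]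
    there. Jets do not move [(a, b)] to first order, so no other derivative contributes; products
    follow Leibniz's rule. *)
Lemma regfun_jet (f : pt C -> C) : regfun f ->
  exists e0 e1 e2, [/\ polyfun2 e0, polyfun2 e1, polyfun2 e2 &
    forall c j, has_jet c j -> exists F, [/\ forall s, f (c s) = F.[s],
      F`_0 = e0 (pa j) (pb j) &
      F`_1 = e1 (pa j) (pb j) * px j + e2 (pa j) (pb j) * py j]].
Proof.
have pc c := polyfun2_const c.
elim=> [c|||||f1 f2 _ [a0 [a1 [a2 [pa0 pa1 pa2 Ha]]]] _ [b0 [b1 [b2 [pb0 pb1 pb2 Hb]]]]
  |f1 f2 _ [a0 [a1 [a2 [pa0 pa1 pa2 Ha]]]] _ [b0 [b1 [b2 [pb0 pb1 pb2 Hb]]]]].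
- exists (fun _ _ => c), (fun _ _ => 0), (fun _ _ => 0); split=> // g j _.
  by exists c%:P; rewrite !coefC !mul0r addr0; split=> // s; rewrite hornerC.
- exists (fun a _ => a), (fun _ _ => 0), (fun _ _ => 0); split=> //.
    by move=> A B; exists A.
  move=> g j [A [B [X [Y [H [A0 A1] _ _ _]]]]].
  by exists A; rewrite A0 A1 !mul0r addr0; split=> // s; rewrite H.
- exists (fun _ b => b), (fun _ _ => 0), (fun _ _ => 0); split=> //.
    by move=> A B; exists B.
  move=> g j [A [B [X [Y [H _ [A0 A1] _ _]]]]].
  by exists B; rewrite A0 A1 !mul0r addr0; split=> // s; rewrite H.
- exists (fun _ _ => 0), (fun _ _ => 1), (fun _ _ => 0); split=> //.
  move=> g j [A [B [X [Y [H _ _ [A0 A1] _]]]]].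
  by exists X; rewrite A0 A1 mul0r mul1r addr0; split=> // s; rewrite H.
- exists (fun _ _ => 0), (fun _ _ => 0), (fun _ _ => 1); split=> //.
  move=> g j [A [B [X [Y [H _ _ _ [A0 A1]]]]]].
  by exists Y; rewrite A0 A1 mul0r mul1r add0r; split=> // s; rewrite H.
- exists (fun a b => a0 a b + b0 a b), (fun a b => a1 a b + b1 a b),
    (fun a b => a2 a b + b2 a b).
  split; try exact: polyfun2_add.
  move=> g j gj; have [[F [HF F0 F1]] [G [HG G0 G1]]] := (Ha g j gj, Hb g j gj).
  exists (F + G); rewrite !coefD F0 F1 G0 G1; split=> //; last by ring.
  by move=> s; rewrite hornerD HF HG.
- exists (fun a b => a0 a b * b0 a b), (fun a b => a0 a b * b1 a b + a1 a b * b0 a b),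
    (fun a b => a0 a b * b2 a b + a2 a b * b0 a b).
  split; try by do ?[apply: polyfun2_mul | apply: polyfun2_add].
  move=> g j gj; have [[F [HF F0 F1]] [G [HG G0 G1]]] := (Ha g j gj, Hb g j gj).
  exists (F * G); rewrite coef1M coef0M F0 F1 G0 G1; split=> //; last by ring.
  by move=> s; rewrite hornerM HF HG.
Qed.

(** By equivariance under the sign change of [(x, y)], along a ray the [(a, b)] components of [psi]
    are even in the parameter and the [(x, y)] components odd; hence jets go to jets. *)
Lemma normal_map_exists psi :
  regular_map psi -> (forall j s, psi (ray j (- s)) = ray (psi (ray j s)) (-1)) ->
  exists a0 b0 n11 n12 n21 n22,
    [/\ polyfun2 a0 /\ polyfun2 b0, polyfun2 n11 /\ polyfun2 n12,
        polyfun2 n21 /\ polyfun2 n22 &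
     normal_map psi (fun u => let a := pa u in let b := pb u in
       Pt (a0 a b) (b0 a b) (n11 a b * px u + n12 a b * py u)
          (n21 a b * px u + n22 a b * py u))].
Proof.
move=> [ra rb rx ry] odd_psi.
have two0 (z : C) : z = - z -> z = 0 by move/eqP; rewrite -addr_eq0 -mulr2n mulrn_eq0 => /eqP.
have flip (eps : C) F : (forall s, F.[- s] = eps * F.[s]) -> F`_0 = eps * F`_0 /\ - F`_1 = eps * F`_1.
  move=> E; have : F \Po (- 'X) = eps *: F.
    by apply: poly_ext => s; rewrite horner_comp hornerN hornerX E hornerZ.
  move=> /esym EF; split; rewrite -coefZ EF.
    by rewrite -!horner_coef0 horner_comp hornerN hornerX oppr0.
  have d0 (P : {poly C}) : P^`().[0] = P`_1.
    by rewrite horner_coef0 coef_deriv mulr1n.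
  rewrite -!d0 deriv_comp derivN derivX hornerM horner_comp hornerN hornerX oppr0.
  by rewrite hornerN hornerC mulrN1.
have even_part f a b x y F : (forall s, f (ray (Pt a b x y) s) = F.[s]) ->
   (forall j s, f (ray j (- s)) = f (ray j s)) -> F`_1 = 0.
  move=> HF Hf; have [s|_ H] := flip 1 F; first by rewrite -!HF Hf mul1r.
  by apply: two0; rewrite H mul1r.
have odd_part f a b x y F : (forall s, f (ray (Pt a b x y) s) = F.[s]) ->
   (forall j s, f (ray j (- s)) = - f (ray j s)) -> F`_0 = 0.
  move=> HF Hf; have [s|H _] := flip (-1) F; first by rewrite -!HF Hf mulN1r.
  by apply: two0; rewrite {1}H mulN1r.
have [a0 [a1 [a2 [pa0 pa1 pa2 Ha]]]] := regfun_jet ra.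
have [b0 [b1 [b2 [pb0 pb1 pb2 Hb]]]] := regfun_jet rb.
have [x0 [x1 [x2 [px0 px1 px2 Hx]]]] := regfun_jet rx.
have [y0 [y1 [y2 [py0 py1 py2 Hy]]]] := regfun_jet ry.
exists a0, b0, x1, x2, y1, y2; split=> // c j cj.
have [A [HA A0 A1]] := Ha c j cj; have [B [HB B0 B1]] := Hb c j cj.
have [X [HX X0 X1]] := Hx c j cj; have [Y [HY Y0 Y1]] := Hy c j cj.
exists A, B, X, Y; case: j {cj} A0 A1 B0 B1 X0 X1 Y0 Y1 => a b x y /= A0 A1 B0 B1 X0 X1 Y0 Y1.
(* The coefficients that must vanish depend on the jet alone, so they may be computed on the ray
   with the same jet, where parity applies. *)
have rj := ray_jet (Pt a b x y).
split; [by move=> s; rewrite -HA -HB -HX -HY; case: (psi (c s)) | | | |]; split=> //.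
- have [F [HF _ F1]] := Ha _ _ rj; rewrite A1 -F1.
  by apply: (even_part (fun u => pa (psi u)) _ _ _ _ _ HF) => u s; rewrite odd_psi.
- have [F [HF _ F1]] := Hb _ _ rj; rewrite B1 -F1.
  by apply: (even_part (fun u => pb (psi u)) _ _ _ _ _ HF) => u s; rewrite odd_psi.
- have [F [HF F0 _]] := Hx _ _ rj; rewrite X0 -F0.
  by apply: (odd_part (fun u => px (psi u)) _ _ _ _ _ HF) => u s; rewrite odd_psi /= mulN1r.
- have [F [HF F0 _]] := Hy _ _ rj; rewrite Y0 -F0.
  by apply: (odd_part (fun u => py (psi u)) _ _ _ _ _ HF) => u s; rewrite odd_psi /= mulN1r.
Qed.

Lemma normal_map_fiberwise psi : regular_map psi ->
  (forall j s, psi (ray j s) = ray (psi j) s) -> normal_map psi psi.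
Proof.
move=> rpsi lin.
have [|a0 [b0 [n11 [n12 [n21 [n22 [_ _ _ H]]]]]]] := normal_map_exists rpsi.
  move=> j s; rewrite lin [psi (ray j s)]lin /ray /=.
  by congr Pt; ring.
move=> c j cj; have := H c j cj; congr has_jet.
apply: has_jet_inj (H _ _ (ray_jet j)) _.
by apply: has_jet_ext (ray_jet (psi j)) => s; rewrite lin.
Qed.

End Jets.

(** * Intertwiners on the slice a = 1 *)

Section Necessity.
Variable C : numClosedFieldType.
Implicit Types (h k p q F : {poly C}) (u v : pt C) (T U z x y a b : C).

(** The action is linear in the fibres, hence its own normal map; the chain rule and uniqueness of
    normal maps carry equivariance over. *)
Lemma equivariant_normal_map n psi (J : pt C -> pt C) :
  normal_map psi J -> equivariant n psi -> equivariant n J.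
Proof.
move=> psiJ psiE t t0.
have actN : normal_map (act n t) (act n t).
  have -> : act n t = fun u => Pt (t ^+ 2 * pa u) (t ^- 2 * pb u) (t ^+ n * px u) (t ^- n * py u) by [].
  apply: normal_map_fiberwise; last first.
    by move=> [a b x y] s; rewrite /ray /=; congr Pt; ring.
  split=> /=.
  - exact: rf_mul (rf_const _) (rf_a C).
  - exact: rf_mul (rf_const _) (rf_b C).
  - exact: rf_mul (rf_const _) (rf_x C).
  - exact: rf_mul (rf_const _) (rf_y C).
apply: normal_map_inj (normal_map_comp psiJ actN) (normal_map_comp actN psiJ).
exact: psiE.
Qed.

Lemma equivariant_inverse n (psi psiinv : pt C -> pt C) :
  cancel psi psiinv -> cancel psiinv psi -> equivariant n psi -> equivariant n psiinv.
Proof. by move=> K K' E t t0 u; rewrite -{1}[u]K' -E // K. Qed.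

(** For odd [n], the element [t = -1] fixes [(a, b)] and negates [(x, y)]. *)
Lemma ray_odd n (psi : pt C -> pt C) : odd n -> equivariant n psi ->
  forall v s, psi (ray v (- s)) = ray (psi (ray v s)) (-1).
Proof.
move=> on psiE v s.
have actN1 u : act n (-1) u = ray u (-1).
  have n1 : (-1) ^+ n = -1 :> C by rewrite -signr_odd on expr1.
  by rewrite /act /ray n1 sqrrN expr1n invrN1 invr1 !mul1r.
rewrite -actN1 -psiE ?oppr_eq0 ?oner_eq0 // actN1.
by congr psi; rewrite /ray /=; congr Pt; ring.
Qed.

(** Since [muh] is not polynomial, conjugation is split off: the relation becomes one between
    regular maps, with [psi] on one side and its complex conjugate on the other. *)
Lemma normal_map_muh n h h' psi (J : pt C -> pt C) :
  cpoly h = h -> cpoly h' = h' -> normal_map psi J ->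
  (forall u, psi (muh n h u) = muh n h' (psi u)) ->
  forall u, J (muh n h u) = muh n h' (J u).
Proof.
move=> hr hr' psiJ E u.
have FN k : normal_map (fun v => phi n k (swap v)) (fun v => phi n k (swap v)).
  apply: normal_map_fiberwise.
    exact: regular_comp (regular_phi n k) (@regular_swap C).
  by move=> [a b x y] s; rewrite /ray /phi /=; congr Pt; ring.
have := normal_map_inj _ (normal_map_comp psiJ (FN h))
  (normal_map_comp (FN h') (normal_map_conj psiJ)).
have conjK v : conjpt (conjpt v) = v by case: v => a b x y; rewrite /conjpt /= !conjCK.
move=> /(_ _ (conjpt u)) ->; first by rewrite conjK.
by move=> v; rewrite -[v]conjK -/(mu0 (conjpt v)) E conjK.
Qed.

Definition slice_form (J : pt C -> pt C) f g p q r s :=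
  forall T x y, J (Pt 1 T x y) =
    Pt f.[T] g.[T] (p.[T] * x + q.[T] * y) (r.[T] * x + s.[T] * y).

(** The real forms exchange [a] and [b] and so leave the slice [a = 1]; a square root of [U] brings
    the point back. *)
Lemma slice_point n z U x y : z != 0 -> z ^+ 2 = U ->
  Pt U 1 x y = act n z (Pt 1 U (z ^- n * x) (z ^+ n * y)).
Proof.
move=> z0 <-; rewrite /act /= mulr1 mulVf ?expf_neq0 //.
by rewrite mulVKf ?mulKf ?expf_neq0.
Qed.

Lemma slice_muh n h U x y :
  muh n h (Pt 1 U^* x^* y^*) =
  Pt U 1 ((1 - 'X * h ^+ 2).[U] * y + ('X^n * h ^+ n).[U] * x)
         ((- h ^+ n).[U] * y + (geom n ('X * h ^+ 2)).[U] * x).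
Proof.
rewrite /muh /= phi_blockmap /blockmap /mu0 /= !conjCK conjC1 mulr1 expr1n mul1r.
by rewrite !(hornerE, hornerXn).
Qed.

Section Slice.
Variables (m : nat) (h h' : {poly C}) (J : pt C -> pt C) (f g p q r s : {poly C}).
Let n := (2 * m + 1)%N.
Hypotheses (hr : cpoly h = h) (hr' : cpoly h' = h').
Hypothesis slice : slice_form J f g p q r s.
Hypothesis JE : equivariant n J.
Hypothesis Jmu : forall u, J (muh n h u) = muh n h' (J u).

Lemma slice_at U x y z : z != 0 -> z ^+ 2 = U ->
  J (Pt U 1 x y) = act n z (Pt f.[U] g.[U]
    (p.[U] * (z ^- n * x) + q.[U] * (z ^+ n * y))
    (r.[U] * (z ^- n * x) + s.[U] * (z ^+ n * y))).
Proof. by move=> z0 zU; rewrite (slice_point n x y z0 zU) JE // slice. Qed.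

Lemma slice_base : g = 'X * cpoly f.
Proof.
have E : 'X * f = cpoly g.
  apply: poly_ext_neq0 => U U0.
  have z0 : sqrtC U != 0 by rewrite sqrtC_eq0.
  have := Jmu (Pt 1 U^* 0^* 0^*).
  rewrite slice_muh (slice_at _ _ z0 (sqrtCK U)) slice => /(congr1 (@pa C)) /=.
  by rewrite sqrtCK hornerM hornerX horner_cpoly.
by rewrite -[LHS]cpolyK -E cpolyM cpolyX.
Qed.

Section Base.
Variable al : C.
Hypotheses (al0 : al != 0) (fE : f = al%:P).
(** On the slice, [J] covers the map from [(1, T)] to [(al, conj(al) T)], so the target form sees
    [h'] at [|al|^2 T]. *)
Let kap := h' \Po ((al * al^*) *: 'X).
Let kapX := (al * al^*) *: 'X * kap ^+ 2.

(** Coordinates of [J mu_h = mu_h' J] on the slice. Returning to the slice costs factors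
    [sqrtC U ^+ n]; clearing them leaves only [U ^+ n], so both relations are polynomial in [U]. *)
Lemma slice_relation U x y : U != 0 ->
  (p.[U] * ((1 - 'X * h ^+ 2).[U] * y + ('X^n * h ^+ n).[U] * x)
   + U ^+ n * q.[U] * ((- h ^+ n).[U] * y + (geom n ('X * h ^+ 2)).[U] * x) =
   (1 - kapX).[U] * ((cpoly r).[U] * x + (cpoly s).[U] * y)
   + al ^+ n * U ^+ n * kap.[U] ^+ n * ((cpoly p).[U] * x + (cpoly q).[U] * y))
  /\ (r.[U] * ((1 - 'X * h ^+ 2).[U] * y + ('X^n * h ^+ n).[U] * x)
   + U ^+ n * s.[U] * ((- h ^+ n).[U] * y + (geom n ('X * h ^+ 2)).[U] * x) =
   U ^+ n * (- (al^* ^+ n * kap.[U] ^+ n) * ((cpoly r).[U] * x + (cpoly s).[U] * y)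
   + (geom n kapX).[U] * ((cpoly p).[U] * x + (cpoly q).[U] * y))).
Proof.
move=> U0; have z0 : sqrtC U != 0 by rewrite sqrtC_eq0.
have zU : sqrtC U ^+ n * sqrtC U ^+ n = U ^+ n by rewrite -exprMn -expr2 sqrtCK.
have zn0 : sqrtC U ^+ n != 0 by rewrite expf_neq0.
have gE : g = al^* *: 'X by rewrite slice_base fE cpolyC mulrC mul_polyC.
have := Jmu (Pt 1 U^* x^* y^*); rewrite slice_muh.
set M1 := _ + _; set M2 := _ + _ => E.
have := E; rewrite (slice_at _ _ z0 (sqrtCK U)) slice fE gE /muh /phi /mu0 /=.
rewrite !hornerC !hornerZ !hornerX !(rmorphM, rmorphD) /= !conjCK -!horner_cpoly.
have -> : al * U * al^* = al * al^* * U by ring.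
have -> : h'.[al * al^* * U] = kap.[U] by rewrite horner_comp !hornerE.
have -> : al * al^* * U * kap.[U] ^+ 2 = kapX.[U].
  by rewrite hornerM hornerZ hornerX horner_exp.
move=> [_ _ E1 E2]; split.
  rewrite -zU; transitivity (sqrtC U ^+ n * (p.[U] * (sqrtC U ^- n * M1) +
      q.[U] * (sqrtC U ^+ n * M2))); first by field.
  by rewrite E1 exprMn zU hornerD hornerN hornerC.
by rewrite horner_geom -E2 -zU; field.
Qed.

Lemma cpoly_kap : cpoly kap = kap.
Proof.
by rewrite /kap cpoly_comp hr' -!mul_polyC !cpolyE rmorphM /= conjCK (mulrC al^*).
Qed.

Lemma slice_poly_relations :
  [/\ p * (1 - 'X * h ^+ 2) - 'X^n * q * h ^+ n =
       (1 - kapX) * cpoly s + 'X^n * (al ^+ n)%:P * kap ^+ n * cpoly q,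
     'X^n * (p * h ^+ n + q * geom n ('X * h ^+ 2)) =
       (1 - kapX) * cpoly r + 'X^n * ((al ^+ n)%:P * kap ^+ n * cpoly p),
     r * (1 - 'X * h ^+ 2) - 'X^n * s * h ^+ n =
       'X^n * (- ((al^* ^+ n)%:P * kap ^+ n * cpoly s) + geom n kapX * cpoly q) &
     'X^n * (r * h ^+ n + s * geom n ('X * h ^+ 2)) =
       'X^n * (- ((al^* ^+ n)%:P * kap ^+ n * cpoly r) + geom n kapX * cpoly p)].
Proof.
pose evE := (hornerM, hornerD, hornerN, hornerC, hornerXn, horner_exp).
split; apply: poly_ext_neq0 => U U0.
- have [E _] := slice_relation 0 1 U0; move: E; rewrite !(mulr0, mulr1, addr0, add0r) => E.
  rewrite hornerD hornerN hornerM [RHS]hornerD [X in _ = X + _]hornerM.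
  have -> : ('X^n * (al ^+ n)%:P * kap ^+ n * cpoly q).[U] =
     al ^+ n * U ^+ n * kap.[U] ^+ n * (cpoly q).[U] by rewrite !evE; ring.
  by rewrite -E !evE; ring.
- have [E _] := slice_relation 1 0 U0; move: E; rewrite !(mulr0, mulr1, addr0, add0r) => E.
  rewrite [RHS]hornerD [X in _ = X + _]hornerM.
  have -> : ('X^n * ((al ^+ n)%:P * kap ^+ n * cpoly p)).[U] =
     al ^+ n * U ^+ n * kap.[U] ^+ n * (cpoly p).[U] by rewrite !evE; ring.
  by rewrite -E !evE; ring.
- have [_ E] := slice_relation 0 1 U0; move: E; rewrite !(mulr0, mulr1, addr0, add0r) => E.
  rewrite [RHS]hornerM hornerXn [X in _ = _ * X]hornerD [X in _ = _ * (_ + X)]hornerM.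
  have -> : (- ((al^* ^+ n)%:P * kap ^+ n * cpoly s)).[U] =
     - (al^* ^+ n * kap.[U] ^+ n) * (cpoly s).[U] by rewrite !evE; ring.
  by rewrite -E !evE; ring.
- have [_ E] := slice_relation 1 0 U0; move: E; rewrite !(mulr0, mulr1, addr0, add0r) => E.
  rewrite [RHS]hornerM hornerXn [X in _ = _ * X]hornerD [X in _ = _ * (_ + X)]hornerM.
  have -> : (- ((al^* ^+ n)%:P * kap ^+ n * cpoly r)).[U] =
     - (al^* ^+ n * kap.[U] ^+ n) * (cpoly r).[U] by rewrite !evE; ring.
  by rewrite -E !evE; ring.
Qed.

Lemma slice_congruence c : c != 0 -> p * s - q * r = c%:P ->
  exists rho : C, [/\ rho \is Num.real, rho != 0 &
    'X^m %| h - rho *: (h' \Po (rho ^+ 2 *: 'X))].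
Proof.
move=> c0 D; have [E1 E2 E3 E4] := slice_poly_relations.
have Xn0 : 'X^n != 0 :> {poly C} by rewrite -size_poly_eq0 size_polyXn.
have cX : cpoly 'X^n = 'X^n :> {poly C} by rewrite cpolyXn cpolyX.
(* Modulo [T^n], [E2] says that [1 - kapX] annihilates [cpoly r], and [geom n kapX] inverts
   [1 - kapX]. *)
have [r0 rE] : exists r0, r = 'X^n * r0.
  have /dvdpP[r0 r0E] : 'X^n %| cpoly r.
    have -> : cpoly r = (1 - kapX) * cpoly r * geom n kapX + kapX ^+ n * cpoly r.
      by rewrite (expr_geom n); ring.
    apply: dvdp_add; last first.
      by rewrite /kapX -mul_polyC !exprMn -!mulrA dvdp_mull // dvdp_mulr.
    apply: dvdp_mulr; have -> : (1 - kapX) * cpoly r =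
      'X^n * (p * h ^+ n + q * geom n ('X * h ^+ 2)) -
      'X^n * ((al ^+ n)%:P * kap ^+ n * cpoly p) by rewrite E2; ring.
    by rewrite -mulrBr dvdp_mulr.
  by exists (cpoly r0); rewrite -[r]cpolyK r0E cpolyM cX mulrC.
(* The modulus of [al] goes into [k(T) = rho h'(rho^2 T)], its phase into [w]. *)
pose rho := `|al|; have rho0 : rho != 0 by rewrite normr_eq0.
have rho_r : rho^* = rho by apply/CrealP; exact: normr_real.
have rho2 : rho ^+ 2 = al * al^* by rewrite normCK.
have [k kE] : exists k, k = rho *: kap by exists (rho *: kap).
have [w wE] : exists w, w = (al / rho) ^+ n by exists ((al / rho) ^+ n).
have kr : cpoly k = k by rewrite kE -mul_polyC cpolyM cpolyC cpoly_kap rho_r.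
have kX : kapX = 'X * k ^+ 2.
  by rewrite /kapX -rho2 kE exprZn -!mul_polyC; ring.
have wk : (al ^+ n)%:P * kap ^+ n = w%:P * k ^+ n.
  by rewrite kE wE exprZn -mul_polyC mulrA -polyCM -exprMn mulfVK.
have wk' : (al^* ^+ n)%:P * kap ^+ n = (w^*)%:P * k ^+ n.
  by rewrite -rmorphXn -!cpolyC -{1}cpoly_kap -cpolyXn -cpolyM wk cpolyM cpolyXn kr.
have ww : w * w^* = 1.
  rewrite wE rmorphXn /= -exprMn rmorphM /= fmorphV /= rho_r mulrACA -rho2 -invfM -expr2.
  by rewrite divff ?expr1n // expf_neq0.
have D' : p * s - 'X^n * q * r0 = c%:P by rewrite -D rE; ring.
have crE : cpoly r = 'X^n * cpoly r0 by rewrite rE !cpolyE.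
move: E1 E2 E3 E4; rewrite kX -!(mulrA 'X^n) !wk !wk' crE rE => E1 E2 E3 E4.
have [e e1 de] : exists2 e : C, e = 1 \/ e = -1 & 'X^m %| h - e *: k.
  apply: (intertwiner_congruence hr kr ww c0 D'); apply: (can_inj (@cpolyK C)).
  - rewrite !(cpolyE, hr, kr, conjCK).
    transitivity (p * (1 - 'X * h ^+ 2) - 'X^n * (q * h ^+ n)); first by ring.
    by rewrite E1; ring.
  - apply: (mulfI Xn0); rewrite !(cpolyE, hr, kr, conjCK) E2; ring.
  - apply: (mulfI Xn0); rewrite !(cpolyE, hr, kr).
    transitivity ('X^n * r0 * (1 - 'X * h ^+ 2) - 'X^n * (s * h ^+ n)); first by ring.
    by rewrite E3; ring.
  - apply: (mulfI Xn0); rewrite !(cpolyE, hr, kr).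
    by rewrite E4; ring.
(* The sign is absorbed into [rho] without changing [rho^2]. *)
exists (e * rho); have ee : e ^+ 2 = 1 by case: e1 => ->; rewrite ?sqrrN expr1n.
split.
- apply/CrealP; rewrite rmorphM /= rho_r.
  by case: e1 => ->; rewrite ?rmorphN rmorph1.
- by rewrite mulf_neq0 //; case: e1 => ->; rewrite ?oppr_eq0 oner_eq0.
by rewrite exprMn ee mul1r rho2 -scalerA -/kap -kE.
Qed.
End Base.

Section Inverse.
Variables (J' : pt C -> pt C) (a0 b0 n11 n12 n21 n22 : C -> C -> C).
Hypothesis J'K : forall u, J' (J u) = u.
Hypothesis J'E : equivariant n J'.
Hypothesis J'form : forall u, J' u = let a := pa u in let b := pb u in
  Pt (a0 a b) (b0 a b) (n11 a b * px u + n12 a b * py u)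
     (n21 a b * px u + n22 a b * py u).
Hypothesis pa0 : polyfun2 a0.
Hypotheses (p11 : polyfun2 n11) (p12 : polyfun2 n12) (p21 : polyfun2 n21) (p22 : polyfun2 n22).

(** [J'] sends [(f(T), g(T), 0, 0)] back to [(1, T, 0, 0)]. By equivariance, comparing
    [a]-coordinates gives [f F(f g) = 1] with [F = a0(1, -)], so [f] is a unit of [C[T]]. *)
Lemma slice_base_unit : exists2 al : C, al != 0 & f = al%:P.
Proof.
have JK T : J' (Pt f.[T] g.[T] 0 0) = Pt 1 T 0 0.
  by rewrite -[RHS]J'K slice !mulr0 !addr0.
have f0 : f != 0.
  apply/eqP => f0; have g0 : g = 0 by rewrite slice_base f0 rmorph0 mulr0.
  have J'0 T : J' (Pt 0 0 0 0) = Pt 1 T 0 0 by rewrite -JK f0 g0 !horner0.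
  have [/esym/eqP] : Pt 1 0 0 0 = Pt 1 1 0 0 :> pt C by rewrite -(J'0 0) (J'0 1).
  by rewrite oner_eq0.
have [F FE] := pa0 1 'X.
have fF : f * (F \Po (f * g)) = 1.
  (* The extra factor [f] covers the zeros of [f], where the torus cannot move the point into the
     slice. *)
  apply: (mulfI f0); rewrite mulr1; apply: poly_ext => T.
  have [fT0 | fT0] := eqVneq f.[T] 0; first by rewrite hornerM fT0 mul0r.
  have z0 : sqrtC f.[T] != 0 by rewrite sqrtC_eq0.
  have := JK T.
  have -> : Pt f.[T] g.[T] 0 0 = act n (sqrtC f.[T]) (Pt 1 (f.[T] * g.[T]) 0 0).
    by rewrite /act /= sqrtCK !mulr0 mulr1 mulKf.
  rewrite J'E // => /(congr1 (@pa C)) /=; rewrite sqrtCK J'form /=.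
  have := FE (f * g).[T]; rewrite hornerC hornerX hornerM => ->.
  by rewrite !hornerM horner_comp hornerM => ->; rewrite mulr1.
have : size f == 1 by rewrite -dvdp1 -fF dvdp_mulr.
by case/size_poly1P => al al0 fE; exists al.
Qed.

(** Along the image of the slice, [J'] gives an inverse matrix with polynomial entries, so the
    determinant is a unit of [C[T]]. *)
Lemma slice_det al : f = al%:P -> exists2 c : C, c != 0 & p * s - q * r = c%:P.
Proof.
move=> fE; have gE : g = al^* *: 'X by rewrite slice_base fE cpolyC mulrC mul_polyC.
have [F11 E11] := p11 f g; have [F12 E12] := p12 f g.
have [F21 E21] := p21 f g; have [F22 E22] := p22 f g.
have JK T x y : J' (J (Pt 1 T x y)) = Pt 1 T x y by rewrite J'K.
have e11 : F11 * p + F12 * r = 1.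
  apply: poly_ext => T; have := JK T 1 0; rewrite slice J'form /= !mulr1 !mulr0 !addr0.
  by move=> [_ _ + _]; rewrite E11 E12 !hornerE.
have e12 : F11 * q + F12 * s = 0.
  apply: poly_ext => T; have := JK T 0 1; rewrite slice J'form /= !mulr1 !mulr0 !add0r.
  by move=> [_ _ + _]; rewrite E11 E12 !hornerE.
have e22 : F21 * q + F22 * s = 1.
  apply: poly_ext => T; have := JK T 0 1; rewrite slice J'form /= !mulr1 !mulr0 !add0r.
  by move=> [_ _ _]; rewrite E21 E22 !hornerE.
have det : (F11 * F22 - F12 * F21) * (p * s - q * r) = 1.
  transitivity ((F11 * p + F12 * r) * (F21 * q + F22 * s)
              - (F11 * q + F12 * s) * (F21 * p + F22 * r)); first by ring.
  by rewrite e11 e12 e22 mul0r subr0 mulr1.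
have : size (p * s - q * r) == 1 by rewrite -dvdp1 -det dvdp_mull.
by case/size_poly1P => c c0 cE; exists c.
Qed.

End Inverse.
End Slice.

End Necessity.

(** * Both implications of the equivalence criterion *)

Lemma equiv_rcf_congruent (C : numClosedFieldType) m (h h' : {poly C})
    (n := (2 * m + 1)%N) :
  cpoly h = h -> cpoly h' = h' -> equiv_rcf n (muh n h) (muh n h') ->
  exists r : C, [/\ r \is Num.real, r != 0 &
    'X^m %| h - r *: (h' \Po (r ^+ 2 *: 'X))].
Proof.
move=> hr hr' [psi [psi' [[rpsi rpsi' K K'] [psiE mu]]]].
have odd_n : odd n by rewrite /n addn1 mul2n /= odd_double.
have psi'E := equivariant_inverse K K' psiE.
have [a0 [b0 [n11 [n12 [n21 [n22 [[pa0 pb0] [p11 p12] [p21 p22] NJ]]]]]]] :=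
  normal_map_exists rpsi (ray_odd odd_n psiE).
have [a0' [b0' [n11' [n12' [n21' [n22' [[pa' _] [p11' p12'] [p21' p22'] NJ']]]]]]] :=
  normal_map_exists rpsi' (ray_odd odd_n psi'E).
set J := (X in normal_map psi X) in NJ.
have JE := equivariant_normal_map NJ psiE.
have JE' := equivariant_normal_map NJ' psi'E.
have JK := normal_map_inj (K : (fun u => psi' (psi u)) =1 id)
  (normal_map_comp NJ' NJ) (fun c j cj => cj).
have Jmu := normal_map_muh hr hr' NJ (fun u => esym (etrans (mu (psi u)) (congr1 _ (congr1 _ (K u))))).
have [f fE] := pa0 1 'X; have [g gE] := pb0 1 'X.
have [p pE] := p11 1 'X; have [q qE] := p12 1 'X.
have [r rE] := p21 1 'X; have [s sE] := p22 1 'X.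
have slice : slice_form J f g p q r s.
  by move=> T x y; rewrite /J /= -fE -gE -pE -qE -rE -sE hornerC hornerX.
have [al al0 alE] := slice_base_unit slice JE Jmu JK JE' (fun u => erefl) pa'.
have [c c0 det] := slice_det slice JE Jmu JK (fun u => erefl) p11' p12' p21' p22' alE.
exact: (slice_congruence hr hr' slice JE Jmu al0 alE c0 det).
Qed.

Theorem theorem3p1 (C : numClosedFieldType) (m : nat) (hm : (1 <= m)%N) :
  let n := (2 * m + 1)%N in
  (forall h : {poly C}, h \is a polyOver Num.real ->
     real_circle_form n (muh n h)) /\
  (forall h h' : {poly C},
     h \is a polyOver Num.real -> h' \is a polyOver Num.real ->
     (equiv_rcf n (muh n h) (muh n h') <->
      exists r : C, [/\ r \is Num.real, r != 0 &
                        'X^m %| h - r *: (h' \Po (r ^+ 2 *: 'X))])).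
Proof.
move=> n; split=> [h /cpoly_real hr|h h' /cpoly_real hr /cpoly_real hr'].
  exact: muh_rcf.
split=> [|[r [rr r0 d]]]; first exact: equiv_rcf_congruent.
(* The intermediate form is that of [r h'(r^2 T)]: congruent to [h] on one side, a rescaling of [h']
   on the other. *)
apply: equiv_rcf_trans (equiv_rescale n h' rr r0).
apply: equiv_congruent => //; last by rewrite -dvdpNr opprB.
by rewrite -!mul_polyC !(cpolyE, cpoly_comp) hr' rmorphXn /= (CrealP rr).
Qed.
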